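(* Let $\varphi=\frac{1+\sqrt5}{2}$ and let $f$ be the analytic function defined in a neighborhood of $z=0$ as the local inverse $f=g^{-1}$, with $f(0)=\varphi$, of the function $$g(w)=\lim_{n\to\infty}(2\varphi)^n\Bigl(\underbrace{\sqrt{1+\sqrt{1+\cdots\sqrt{1+w}}}}_{n}-\varphi\Bigr),$$ which is analytic near $w=\varphi$. Then $f$ can be extended to an entire function of exponential type; its order does not exceed $1$.
   Context: The expression with underbrace $n$ denotes the $n$-fold composition of the map $w\mapsto\sqrt{1+w}$ applied to $w$, where the branch of the square root is the one with $\sqrt{1+\varphi}=\varphi$, analytic in a neighborhood of $w=\varphi$. The function $g$ is analytic in a neighborhood of $w=\varphi$ with $g(\varphi)=0$ and $g'(\varphi)=1$, so it has an analytic local inverse $f$ near $z=0$ with $f(0)=\varphi$, $f'(0)=1$. This $f$ satisfies $f(2\varphi z)=f(z)^2-1$ near $0$. An entire function $F$ is of exponential type if $|F(z)|\le Ae^{B|z|}$ for all $z\in\mathbb{C}$ and some constants $A,B>0$. *)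

(* Defs.v *)
From Stdlib Require Import Reals.
From Coquelicot Require Import Coquelicot.

Open Scope R_scope.

Definition phi : R := (1 + sqrt 5) / 2.

Definition C_differentiable (f : C -> C) (z : C) : Prop :=
  @ex_derive C_AbsRing C_NormedModule f z.

(* Analyticity is complex differentiability on a whole neighborhood of the
   point.  Functions are total; only their germ at [z0] matters here. *)
Definition analytic_at (f : C -> C) (z0 : C) : Prop :=
  locally z0 (fun z => C_differentiable f z).

Definition entire (f : C -> C) : Prop :=
  forall z : C, C_differentiable f z.

(* [s] is the branch of [w |-> sqrt (1 + w)] near [phi] such that
   [sqrt (1 + phi) = phi]. *)
Definition sqrt1_branch (s : C -> C) : Prop :=
  analytic_at s phi /\
  s phi = phi /\
  locally (phi : C) (fun w => (s w * s w = 1 + w)%C).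

Definition nested_sqrt (s : C -> C) (n : nat) (w : C) : C := Nat.iter n s w.

(* Near [phi], [g w = lim (2 phi)^n (nested_sqrt s n w - phi)]. *)
Definition is_nested_sqrt_limit (s g : C -> C) : Prop :=
  locally (phi : C) (fun w =>
    filterlim
      (fun n : nat =>
         (RtoC (2 * phi) ^ n * (nested_sqrt s n w - RtoC phi))%C)
      eventually (locally (g w))).

(* [f], analytic near [0] with [f 0 = phi], is the local inverse of [g] there. *)
Definition is_local_inverse (g f : C -> C) : Prop :=
  analytic_at f 0 /\
  f 0 = phi /\
  locally (0 : C) (fun z => g (f z) = z) /\
  locally (phi : C) (fun w => f (g w) = w).

Definition exponential_type (F : C -> C) : Prop :=
  exists A B : R, 0 < A /\ 0 < B /\
    forall z : C, Cmod (F z) <= A * exp (B * Cmod z).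

(* Order of growth: the infimum (in the extended reals, [p_infty] if there is
   none) of the [rho >= 0] such that [|F z| <= exp (|z| ^ rho)] for all
   sufficiently large [|z|].  The bound [0 < r] keeps [Rpower] away from its
   conventional values at nonpositive bases. *)
Definition order (F : C -> C) : Rbar :=
  Glb_Rbar (fun rho : R =>
    0 <= rho /\
    exists r : R, 0 < r /\
      forall z : C, r < Cmod z -> Cmod (F z) <= exp (Rpower (Cmod z) rho)).

(* Main.v *)
Require Import Defs.
From Stdlib Require Import Reals Lra Lia Factorial.
From Coquelicot Require Import Coquelicot.

Open Scope R_scope.

(** The map [w |-> sqrt (1 + w)] is the local inverse at its fixed point [phi] of
    [w |-> w^2 - 1], whose multiplier there is [2 phi].  Instead of studying the
    limit [g], one constructs its inverse directly: the entire solution of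

      F (2 phi z) = F(z)^2 - 1,   F(0) = phi,   F'(0) = 1

    (the Poincare function of [w^2 - 1] at [phi], called [poincare]).  Comparing
    coefficients, [F(z) = phi + sum b_n z^(n+1)] with [b_0 = 1] and

      ((2 phi)^(n+2) - 2 phi) b_(n+1) = sum_(k <= n) b_k b_(n-k),

    and an induction based on the binomial theorem gives
    [0 <= b_n <= 2^-n / (n+1)!] ([poincare_tail_bounds]).  Hence [F] is entire and
    [|F z| <= 2 exp (|z| / 2)] ([poincare_growth]), which yields both the exponential
    type and the order; the equation itself ([poincare_functional]) is a Cauchy
    product.

    As [F'(0) = 1], [F] has an analytic local inverse [G] at [phi]
    ([poincare_inverse]), obtained from a contraction argument.  Near [z = 0] the
    functional equation says that [F (z / (2 phi))] is the root of [1 + F z] in the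
    right half-plane, so any admissible branch [s] satisfies
    [s^n (F z) = F (z / (2 phi)^n)] ([nested_sqrt_poincare]).  Therefore
    [(2 phi)^n (s^n (F z) - phi)] tends to [F'(0) z = z]
    ([poincare_linearization]): the limit [g] exists near [phi] and agrees with [G]
    there.  So [g] is analytic, [F] is a local inverse of it, and every other local
    inverse has the same germ at 0.  A branch [s] exists because
    [w |-> F (G w / (2 phi))] is one. *)

(** * Complex differentiability and convergence *)

Lemma locally_Cmod (z : C) (P : C -> Prop) :
  locally z P <->
  exists d : R, 0 < d /\ forall w, Cmod (w - z) < d -> P w.
Proof.
  split.
  - intros H.
    destruct (locally_norm_le_locally (V := C_NormedModule) z P H) as [d Hd].
    exists d. split; [apply cond_pos|]. intros w Hw. apply Hd. exact Hw.
  - intros [d [Hd H]].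
    apply (locally_le_locally_norm (V := C_NormedModule) z P).
    exists (mkposreal d Hd). intros w Hw. apply H. exact Hw.
Qed.

Lemma locally_Cmod_ball (z : C) (eps : R) :
  0 < eps -> locally z (fun w => Cmod (w - z) < eps).
Proof. intros Heps. apply locally_Cmod. exists eps. auto. Qed.

(** In a derivative the domain carries the uniform structure of the absolute ring
    C and the codomain that of the plane; this form in terms of moduli hides the
    difference. *)
Lemma C_differentiable_Cmod (f : C -> C) (z : C) :
  C_differentiable f z <->
  exists l : C, forall eps, 0 < eps -> exists d, 0 < d /\
    forall w, Cmod (w - z) < d ->
      Cmod (f w - f z - l * (w - z)) <= eps * Cmod (w - z).
Proof.
  split.
  - intros [l [_ Hl]]. exists l. intros eps Heps.
    specialize (Hl z (fun P HP => HP) (mkposreal eps Heps)).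
    apply locally_C, locally_Cmod in Hl.
    destruct Hl as [d [Hd H]]. exists d. split; [exact Hd|].
    intros w Hw. specialize (H w Hw). cbn in H.
    rewrite Cmult_comm. exact H.
  - intros [l H]. exists l. split.
    + apply is_linear_scal_l.
    + intros x Hx.
      rewrite <- (is_filter_lim_locally_unique _ _ Hx).
      intros [eps Heps].
      apply locally_C, locally_Cmod.
      destruct (H eps Heps) as [d [Hd Hw]]. exists d. split; [exact Hd|].
      intros w Hw'. specialize (Hw w Hw'). cbn.
      rewrite Cmult_comm in Hw. exact Hw.
Qed.

Lemma C_differentiable_comp (f g : C -> C) (z : C) :
  C_differentiable g z -> C_differentiable f (g z) ->
  C_differentiable (fun w => f (g w)) z.
Proof.
  rewrite !C_differentiable_Cmod.
  intros [l Hg] [m Hf]. exists (m * l)%C. intros eps Heps.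
  assert (Hl := Cmod_ge_0 l). assert (Hm := Cmod_ge_0 m).
  set (e1 := eps / (2 * (Cmod l + 1))).
  assert (He1 : 0 < e1) by (apply Rdiv_lt_0_compat; lra).
  set (e2 := eps / (2 * (Cmod m + 1))).
  assert (He2 : 0 < e2) by (apply Rdiv_lt_0_compat; lra).
  destruct (Hf e1 He1) as [d1 [Hd1 Hf1]].
  destruct (Hg 1 Rlt_0_1) as [d2 [Hd2 Hg2]].
  destruct (Hg e2 He2) as [d3 [Hd3 Hg3]].
  assert (Hd4 : 0 < d1 / (Cmod l + 1)) by (apply Rdiv_lt_0_compat; lra).
  exists (Rmin (Rmin d2 d3) (d1 / (Cmod l + 1))).
  split; [repeat apply Rmin_glb_lt; assumption|].
  intros w Hw.
  apply Rmin_Rgt_l in Hw as [Hw Hw1]. apply Rmin_Rgt_l in Hw as [Hw2 Hw3].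
  specialize (Hg2 w Hw2). specialize (Hg3 w Hw3).
  assert (Hlip : Cmod (g w - g z) <= (Cmod l + 1) * Cmod (w - z)).
  { replace (g w - g z)%C with ((g w - g z - l * (w - z)) + l * (w - z))%C by ring.
    eapply Rle_trans; [apply Cmod_triangle|]. rewrite Cmod_mult. lra. }
  assert (Hgd : Cmod (g w - g z) < d1).
  { eapply Rle_lt_trans; [exact Hlip|].
    apply Rmult_lt_reg_r with (/ (Cmod l + 1)); [apply Rinv_0_lt_compat; lra|].
    replace ((Cmod l + 1) * Cmod (w - z) * / (Cmod l + 1)) with (Cmod (w - z))
      by (field; lra). exact Hw1. }
  specialize (Hf1 _ Hgd).
  replace (f (g w) - f (g z) - m * l * (w - z))%C
    with ((f (g w) - f (g z) - m * (g w - g z)) + m * (g w - g z - l * (w - z)))%C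
    by ring.
  eapply Rle_trans; [apply Cmod_triangle|]. rewrite Cmod_mult.
  assert (E1 : e1 * Cmod (g w - g z) <= eps / 2 * Cmod (w - z)).
  { replace (eps / 2 * Cmod (w - z)) with (e1 * ((Cmod l + 1) * Cmod (w - z)))
      by (unfold e1; field; lra).
    apply Rmult_le_compat_l; lra. }
  assert (E2 : Cmod m * Cmod (g w - g z - l * (w - z)) <= eps / 2 * Cmod (w - z)).
  { replace (eps / 2 * Cmod (w - z)) with ((Cmod m + 1) * (e2 * Cmod (w - z)))
      by (unfold e2; field; lra).
    apply Rmult_le_compat; [lra|apply Cmod_ge_0|lra|exact Hg3]. }
  lra.
Qed.

Lemma C_differentiable_scale (c z : C) : C_differentiable (fun w => c * w)%C z.
Proof.
  apply C_differentiable_Cmod. exists c. intros eps Heps. exists 1.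
  split; [lra|]. intros w _.
  replace (c * w - c * z - c * (w - z))%C with (RtoC 0) by ring.
  rewrite Cmod_0. apply Rmult_le_pos; [lra|apply Cmod_ge_0].
Qed.

Lemma C_differentiable_continuous (f : C -> C) (z : C) :
  C_differentiable f z ->
  forall P : C -> Prop, locally (f z) P -> locally z (fun w => P (f w)).
Proof.
  intros Hf P HP. apply locally_C. exact (ex_derive_continuous f z Hf P HP).
Qed.

Lemma analytic_at_ext_loc (f g : C -> C) (z : C) :
  locally z (fun w => f w = g w) -> analytic_at f z -> analytic_at g z.
Proof.
  intros E Hf. unfold analytic_at in *.
  apply locally_locally in E. generalize (filter_and _ _ E Hf).
  apply filter_imp. intros w [Ew Hw].
  apply (ex_derive_ext_loc f g); [|exact Hw]. apply locally_C, Ew.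
Qed.

Lemma filterlim_Cmod (u : nat -> C) (l : C) :
  filterlim u eventually (locally l) <->
  forall eps, 0 < eps -> exists N, forall n, (N <= n)%nat -> Cmod (u n - l) < eps.
Proof.
  split.
  - intros H eps Heps.
    apply (H (fun w => Cmod (w - l) < eps)). apply locally_Cmod.
    exists eps. auto.
  - intros H P HP. apply locally_Cmod in HP. destruct HP as [d [Hd HP]].
    destruct (H d Hd) as [N HN]. exists N. intros n Hn. apply HP, HN, Hn.
Qed.

Lemma is_series_C_unique (a : nat -> C) (l m : C) :
  is_series a l -> is_series a m -> l = m.
Proof.
  intros Hl Hm.
  exact (filterlim_locally_unique (V := C_NormedModule) _ _ _ Hl Hm).
Qed.

Lemma is_series_C_minus (a b : nat -> C) (l m : C) :
  is_series a l -> is_series b m -> is_series (fun n => a n - b n)%C (l - m)%C.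
Proof. apply (is_series_minus (V := C_NormedModule)). Qed.

Lemma is_series_C_scal (c : C) (a : nat -> C) (l : C) :
  is_series a l -> is_series (fun n => c * a n)%C (c * l)%C.
Proof. apply (is_series_scal_l (V := C_NormedModule)). Qed.

Lemma is_series_shift (a : nat -> C) (l : C) :
  is_series a l <-> is_series (fun n => a (S n)) (l - a 0%nat)%C.
Proof.
  split; intros H.
  - apply (is_series_incr_1 (V := C_NormedModule)).
    refine (eq_ind l (fun m : C => is_series a m) H _ _).
    change (l = (l - a 0%nat) + a 0%nat)%C. ring.
  - apply (is_series_decr_1 (V := C_NormedModule)). exact H.
Qed.

Lemma is_series_Cmod (a : nat -> C) (l : C) :
  is_series a l <-> is_lim_seq (fun n => Cmod (sum_n a n - l)) 0.
Proof.
  unfold is_series. rewrite (filterlim_Cmod (sum_n a) l).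
  rewrite <- is_lim_seq_spec.
  split; intros H.
  - intros [eps Heps]. destruct (H eps Heps) as [N HN]. exists N.
    intros n Hn. simpl. rewrite Rminus_0_r, Rabs_pos_eq by apply Cmod_ge_0.
    apply HN, Hn.
  - intros eps Heps. destruct (H (mkposreal eps Heps)) as [N HN]. exists N.
    intros n Hn. specialize (HN n Hn). simpl in HN.
    rewrite Rminus_0_r, Rabs_pos_eq in HN by apply Cmod_ge_0. exact HN.
Qed.

Lemma is_series_Cmod_le (a : nat -> C) (b : nat -> R) (l : C) (m : R) :
  (forall n, Cmod (a n) <= b n) -> is_series a l -> is_series b m -> Cmod l <= m.
Proof.
  intros Hab Ha Hb.
  assert (Hs : forall n, Cmod (sum_n a n) <= sum_n b n).
  { induction n as [|n IH].
    - rewrite !sum_O. apply Hab.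
    - rewrite !sum_Sn. eapply Rle_trans; [apply Cmod_triangle|].
      apply Rplus_le_compat; [exact IH|apply Hab]. }
  apply (is_lim_seq_le (fun n => Cmod (sum_n a n)) (sum_n b) (Cmod l) m Hs).
  - apply (filterlim_comp _ _ _ (sum_n a) Cmod eventually (locally l)).
    + exact Ha.
    + apply (filterlim_norm (V := C_NormedModule)).
  - exact Hb.
Qed.

(** * Local inversion of maps close to a translation *)

(** [F] is a translation up to a 1/2-contraction, so a derivative of [F] inside the
    disc can only lie within 1/2 of 1. *)
Definition near_id (F : C -> C) (r : R) : Prop :=
  forall x y, Cmod x <= r -> Cmod y <= r ->
    Cmod (F x - F y - (x - y)) <= / 2 * Cmod (x - y).

Lemma near_id_expanding (F : C -> C) (r : R) (x y : C) :
  near_id F r -> Cmod x <= r -> Cmod y <= r ->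
  Cmod (x - y) <= 2 * Cmod (F x - F y).
Proof.
  intros HF Hx Hy. specialize (HF x y Hx Hy).
  assert (H : Cmod (x - y) <= Cmod (F x - F y) + Cmod (F x - F y - (x - y))).
  { replace (x - y)%C with ((F x - F y) + - (F x - F y - (x - y)))%C at 1 by ring.
    rewrite <- (Cmod_opp (F x - F y - (x - y))). apply Cmod_triangle. }
  lra.
Qed.

Lemma near_id_lipschitz (F : C -> C) (r : R) (x y : C) :
  near_id F r -> Cmod x <= r -> Cmod y <= r ->
  Cmod (F x - F y) <= 2 * Cmod (x - y).
Proof.
  intros HF Hx Hy. specialize (HF x y Hx Hy).
  replace (F x - F y)%C with ((F x - F y - (x - y)) + (x - y))%C by ring.
  eapply Rle_trans; [apply Cmod_triangle|].
  assert (H := Cmod_ge_0 (x - y)). lra.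
Qed.

(** Picard iteration from 0: by [near_id] each step at least halves the
    residual [w - F z], so the iterates converge and travel less than [r] in total. *)
Lemma near_id_surjective (F : C -> C) (r : R) (w : C) :
  near_id F r -> Cmod (w - F 0) < r / 2 ->
  exists z, Cmod z < r /\ F z = w.
Proof.
  intros HF. set (e := Cmod (w - F 0)). intros He.
  assert (He0 : 0 <= e) by apply Cmod_ge_0.
  (* u is the Picard iteration for z = z + (w - F z), and d its increments *)
  set (u := fun n => Nat.iter n (fun z => z + (w - F z))%C (RtoC 0)).
  set (d := fun n => (w - F (u n))%C).
  assert (Hu : forall n, Cmod (u n) <= 2 * e * (1 - (/ 2) ^ n)
                         /\ Cmod (d n) <= e * (/ 2) ^ n).
  { induction n as [|n [IH1 IH2]].
    - unfold d, u. simpl. rewrite Cmod_0. fold e. lra.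
    - assert (Hp : 0 < (/ 2) ^ n) by (apply pow_lt; lra).
      assert (Hep : 0 <= e * (/ 2) ^ n) by (apply Rmult_le_pos; lra).
      assert (H1 : Cmod (u (S n)) <= 2 * e * (1 - (/ 2) ^ S n)).
      { change (u (S n)) with (u n + d n)%C.
        eapply Rle_trans; [apply Cmod_triangle|]. simpl. lra. }
      split; [exact H1|].
      assert (H := HF (u (S n)) (u n) ltac:(simpl pow in H1; lra) ltac:(lra)).
      replace (u (S n) - u n)%C with (d n) in H
        by (change (u (S n)) with (u n + d n)%C; ring).
      replace (d (S n)) with (- (F (u (S n)) - F (u n) - d n))%C
        by (unfold d; ring).
      rewrite Cmod_opp. simpl pow. lra. }
  assert (Hg : is_series (fun n => e * (/ 2) ^ n) (e * / (1 - / 2))).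
  { apply (is_series_scal_l (V := R_NormedModule)), is_series_geom.
    rewrite Rabs_pos_eq; lra. }
  destruct (ex_series_le (V := C_CompleteNormedModule) d (fun n => e * (/ 2) ^ n))
    as [z Hz].
  { intros n. apply Hu. }
  { eexists. exact Hg. }
  assert (Hzr : Cmod z < r).
  { eapply Rle_lt_trans; [
      exact (is_series_Cmod_le _ _ _ _ (fun n => proj2 (Hu n)) Hz Hg)|].
    lra. }
  exists z. split; [exact Hzr|].
  assert (Hsum : forall n, sum_n d n = u (S n)).
  { induction n as [|n IH].
    - rewrite sum_O. unfold d, u. simpl. ring.
    - rewrite sum_Sn, IH. reflexivity. }
  apply is_series_Cmod in Hz.
  assert (H0 : Cmod (w - F z) <= 0).
  { apply (is_lim_seq_le (fun _ => Cmod (w - F z))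
             (fun n => e * (/ 2) ^ S n + 2 * Cmod (sum_n d n - z))
             (Cmod (w - F z)) 0).
    - intros n. rewrite Hsum.
      replace (w - F z)%C with (d (S n) + (F (u (S n)) - F z))%C
        by (unfold d; ring).
      eapply Rle_trans; [apply Cmod_triangle|].
      apply Rplus_le_compat; [apply Hu|].
      apply (near_id_lipschitz F r); [exact HF| |lra].
      destruct (Hu (S n)) as [H _].
      assert (Hp : 0 < (/ 2) ^ S n) by (apply pow_lt; lra).
      assert (Hep : 0 <= e * (/ 2) ^ S n) by (apply Rmult_le_pos; lra). lra.
    - apply is_lim_seq_const.
    - replace 0 with (e * 0 + 2 * 0) by ring.
      apply is_lim_seq_plus'; apply is_lim_seq_mult';
        try apply is_lim_seq_const; [|exact Hz].
      apply (is_lim_seq_incr_1 (fun n => (/ 2) ^ n)), is_lim_seq_geom.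
      rewrite Rabs_pos_eq; lra. }
  assert (H1 : (w - F z)%C = 0%C)
    by (apply Cmod_eq_0, Rle_antisym; [exact H0|apply Cmod_ge_0]).
  replace (F z) with (w - (w - F z))%C by ring. rewrite H1. ring.
Qed.

(** Distances shrink under [F] by a factor of at most 2, so [F] is injective with
    nonzero derivative, and the linearization error of [F] at a point bounds that
    of [G] at its image. *)
Lemma near_id_inverse (F : C -> C) (r : R) :
  0 < r -> near_id F r ->
  (forall z, Cmod z < r -> C_differentiable F z) ->
  exists G : C -> C,
    (forall z, Cmod z < r -> G (F z) = z) /\
    (forall w, Cmod (w - F 0) < r / 2 ->
       Cmod (G w) < r /\ F (G w) = w /\ C_differentiable G w).
Proof.
  intros Hr HF HD.
  set (G := fun w => iota (T := CompleteNormedModule.CompleteSpace _ C_CompleteNormedModule)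
                       (fun z : C => Cmod z < r /\ F z = w)).
  assert (Hinj : forall x y, Cmod x < r -> Cmod y < r -> F x = F y -> x = y).
  { intros x y Hx Hy E.
    assert (H := near_id_expanding F r x y HF ltac:(lra) ltac:(lra)).
    rewrite E in H. replace (F y - F y)%C with (RtoC 0) in H by ring.
    rewrite Cmod_0, Rmult_0_r in H.
    assert (H1 : (x - y)%C = 0%C)
      by (apply Cmod_eq_0, Rle_antisym; [exact H|apply Cmod_ge_0]).
    replace x with (x - y + y)%C by ring. rewrite H1. ring. }
  assert (HG1 : forall z, Cmod z < r -> G (F z) = z).
  { intros z Hz.
    refine (iota_unique (V := C_CompleteNormedModule)
              (fun x : C => Cmod x < r /\ F x = F z) z _ (conj Hz eq_refl)).
    intros y [Hy E]. exact (Hinj y z Hy Hz E). }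
  assert (HG2 : forall w, Cmod (w - F 0) < r / 2 -> Cmod (G w) < r /\ F (G w) = w).
  { intros w Hw. destruct (near_id_surjective F r w HF Hw) as [z [Hz E]].
    subst w. rewrite (HG1 z Hz). auto. }
  exists G. split; [exact HG1|]. intros w0 Hw0.
  destruct (HG2 w0 Hw0) as [Hz0 Hw0']. split; [exact Hz0|]. split; [exact Hw0'|].
  set (z0 := G w0) in *.
  destruct (proj1 (C_differentiable_Cmod F z0) (HD z0 Hz0)) as [l Hl].
  (* if the derivative vanished, F would contract small steps at z0 by more
     than its expansion factor 1/2 allows *)
  assert (Hl0 : l <> 0%C).
  { intros E. subst l.
    destruct (Hl (/ 4) ltac:(lra)) as [d [Hd H]].
    set (t := Rmin (d / 2) ((r - Cmod z0) / 2)).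
    assert (Ht : 0 < t) by (apply Rmin_glb_lt; lra).
    assert (Ht1 : t <= d / 2) by apply Rmin_l.
    assert (Ht2 : t <= (r - Cmod z0) / 2) by apply Rmin_r.
    assert (Hz1 : Cmod (z0 + t) <= r).
    { eapply Rle_trans; [apply Cmod_triangle|].
      rewrite Cmod_R, Rabs_pos_eq; lra. }
    specialize (H (z0 + t)%C).
    assert (H1 := near_id_expanding F r (z0 + t) z0 HF Hz1 ltac:(lra)).
    replace (z0 + t - z0)%C with (RtoC t) in H, H1 by ring.
    rewrite Cmod_R, Rabs_pos_eq in H, H1 by lra.
    specialize (H ltac:(lra)).
    replace (F (z0 + t) - F z0 - 0 * t)%C with (F (z0 + t) - F z0)%C in H by ring.
    lra. }
  assert (Hlm : 0 < Cmod l) by (apply Cmod_gt_0, Hl0).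
  apply C_differentiable_Cmod. exists (/ l)%C. intros eps Heps.
  (* the error of F at z0, divided by l, is an error in w, as |z - z0| is at
     most twice |w - w0| *)
  set (e' := eps * Cmod l / 2).
  assert (He' : 0 < e').
  { unfold e'. assert (0 < eps * Cmod l) by (apply Rmult_lt_0_compat; assumption). lra. }
  destruct (Hl e' He') as [d [Hd H]].
  exists (Rmin (d / 2) (r / 2 - Cmod (w0 - F 0))).
  split; [apply Rmin_glb_lt; lra|].
  intros w Hw. apply Rmin_Rgt_l in Hw as [Hw1 Hw2].
  assert (Hw3 : Cmod (w - F 0) < r / 2).
  { replace (w - F 0)%C with ((w - w0) + (w0 - F 0))%C by ring.
    eapply Rle_lt_trans; [apply Cmod_triangle|]. lra. }
  destruct (HG2 w Hw3) as [Hz Hw']. set (z := G w) in *.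
  assert (He := near_id_expanding F r z z0 HF ltac:(lra) ltac:(lra)).
  rewrite Hw', Hw0' in He. fold z0.
  specialize (H z ltac:(lra)). rewrite Hw', Hw0' in H.
  replace (z - z0 - / l * (w - w0))%C with (- (/ l * (w - w0 - l * (z - z0))))%C
    by (field; exact Hl0).
  rewrite Cmod_opp, Cmod_mult, Cmod_inv by exact Hl0.
  apply Rmult_le_reg_l with (Cmod l); [exact Hlm|].
  rewrite <- Rmult_assoc, Rinv_r, Rmult_1_l by lra.
  eapply Rle_trans; [exact H|].
  apply Rle_trans with (e' * (2 * Cmod (w - w0))).
  - apply Rmult_le_compat_l; lra.
  - right. unfold e'. field.
Qed.

(** * Entire power series *)

Lemma is_series_exp (x : R) : is_series (fun n => x ^ n / INR (fact n)) (exp x).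
Proof.
  apply (is_series_ext (fun n => / INR (fact n) * x ^ n)).
  - intros n. apply Rmult_comm.
  - exact (proj1 (is_pseries_R _ _ _) (is_exp_Reals x)).
Qed.

Lemma is_series_exp_scal (K x : R) :
  is_series (fun n => K * (x ^ n / INR (fact n))) (K * exp x).
Proof. apply (is_series_scal_l (V := R_NormedModule)), is_series_exp. Qed.

(** Such a coefficient sequence defines an entire function of exponential type,
    and the bound passes to the formal derivative with the same [K]. *)
Definition exp_bounded (K : R) (a : nat -> C) : Prop :=
  forall n, Cmod (a n) <= K / INR (fact n).

Lemma exp_bounded_ge_0 (K : R) (a : nat -> C) : exp_bounded K a -> 0 <= K.
Proof.
  intros Ha. specialize (Ha 0%nat). simpl in Ha.
  assert (H := Cmod_ge_0 (a 0%nat)). lra.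
Qed.

Lemma exp_bounded_term (K : R) (a : nat -> C) (n : nat) (z : C) :
  exp_bounded K a -> Cmod (a n * z ^ n) <= K * (Cmod z ^ n / INR (fact n)).
Proof.
  intros Ha. rewrite Cmod_mult, Cmod_pow.
  replace (K * (Cmod z ^ n / INR (fact n))) with (K / INR (fact n) * Cmod z ^ n)
    by (unfold Rdiv; ring).
  apply Rmult_le_compat_r; [apply pow_le, Cmod_ge_0|apply Ha].
Qed.

Lemma ex_series_Cmod_exp_bounded (K : R) (a : nat -> C) (z : C) :
  exp_bounded K a -> ex_series (fun n => Cmod (a n * z ^ n)).
Proof.
  intros Ha.
  apply (ex_series_le (V := R_CompleteNormedModule) _
           (fun n => K * (Cmod z ^ n / INR (fact n)))).
  - intros n. change (Rabs (Cmod (a n * z ^ n)) <= K * (Cmod z ^ n / INR (fact n))).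
    rewrite Rabs_pos_eq by apply Cmod_ge_0. apply exp_bounded_term, Ha.
  - eexists. apply is_series_exp_scal.
Qed.

Definition CPSeries (a : nat -> C) (z : C) : C :=
  iota (T := CompleteNormedModule.CompleteSpace _ C_CompleteNormedModule)
    (fun l : C => is_series (fun n => (a n * z ^ n)%C) l).

Lemma CPSeries_correct (K : R) (a : nat -> C) (z : C) :
  exp_bounded K a ->
  is_series (fun n => (a n * z ^ n)%C) (CPSeries a z : C).
Proof.
  intros Ha.
  destruct (ex_series_le (V := C_CompleteNormedModule)
    (fun n => (a n * z ^ n)%C) (fun n => K * (Cmod z ^ n / INR (fact n))))
    as [l Hl].
  - intros n. exact (exp_bounded_term K a n z Ha).
  - eexists. apply is_series_exp_scal.
  - refine (iota_correct (V := C_CompleteNormedModule)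
              (fun l : C => is_series (fun n => (a n * z ^ n)%C) l) _).
    exists l. split; [exact Hl|]. intros m Hm.
    exact (is_series_C_unique _ _ _ Hl Hm).
Qed.

Lemma CPSeries_unique (a : nat -> C) (z l : C) :
  is_series (fun n => (a n * z ^ n)%C) l -> CPSeries a z = l.
Proof.
  intros Hl.
  refine (iota_unique (V := C_CompleteNormedModule)
            (fun l : C => is_series (fun n => (a n * z ^ n)%C) l) l _ Hl).
  intros m Hm. exact (is_series_C_unique _ _ _ Hm Hl).
Qed.

Lemma is_series_C_0 (a : nat -> C) :
  (forall n, a (S n) = 0%C) -> is_series a (a 0%nat).
Proof.
  intros Ha. apply (filterlim_ext (fun _ => a 0%nat)); [|apply filterlim_const].
  intros n. induction n as [|n IH]; [now rewrite sum_O|].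
  rewrite sum_Sn, <- IH, Ha. symmetry. apply (Cplus_0_r (a 0%nat)).
Qed.

Lemma CPSeries_0 (a : nat -> C) : CPSeries a 0 = a 0%nat.
Proof.
  apply CPSeries_unique.
  replace (a 0%nat) with (a 0%nat * 0 ^ 0)%C by (simpl; ring).
  apply (is_series_C_0 (fun n => (a n * 0 ^ n)%C)). intros n. simpl. ring.
Qed.

Definition derive_coefs (a : nat -> C) (n : nat) : C := (INR (S n) * a (S n))%C.

Lemma exp_bounded_derive (K : R) (a : nat -> C) :
  exp_bounded K a -> exp_bounded K (derive_coefs a).
Proof.
  intros Ha n. unfold derive_coefs.
  rewrite Cmod_mult, Cmod_R, Rabs_pos_eq by apply pos_INR.
  assert (H := Ha (S n)). rewrite fact_simpl, mult_INR in H.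
  assert (Hn : 0 < INR (S n)) by (apply lt_0_INR; lia).
  assert (Hf := INR_fact_lt_0 n).
  apply Rmult_le_compat_l with (r := INR (S n)) in H; [|lra].
  eapply Rle_trans; [exact H|]. right. field. split; lra.
Qed.

Lemma Cmod_pow_sub_le (r : R) (x y : C) (n : nat) :
  Cmod x <= r -> Cmod y <= r ->
  Cmod (x ^ S n - y ^ S n) <= INR (S n) * r ^ n * Cmod (x - y).
Proof.
  intros Hx Hy.
  assert (Hr := Rle_trans _ _ _ (Cmod_ge_0 x) Hx).
  induction n as [|n IH].
  - replace (x ^ 1 - y ^ 1)%C with (x - y)%C by (simpl; ring). simpl. lra.
  - replace (x ^ S (S n) - y ^ S (S n))%C
      with (x * (x ^ S n - y ^ S n) + (x - y) * y ^ S n)%C by (simpl; ring).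
    eapply Rle_trans; [apply Cmod_triangle|]. rewrite !Cmod_mult, Cmod_pow.
    assert (H1 : Cmod x * Cmod (x ^ S n - y ^ S n)
                 <= r * (INR (S n) * r ^ n * Cmod (x - y)))
      by (apply Rmult_le_compat; auto using Cmod_ge_0).
    assert (H2 : Cmod (x - y) * Cmod y ^ S n <= Cmod (x - y) * r ^ S n)
      by (apply Rmult_le_compat_l; [apply Cmod_ge_0|
          apply pow_incr; split; [apply Cmod_ge_0|exact Hy]]).
    rewrite (S_INR (S n)). simpl (r ^ S n) in *. nra.
Qed.

Lemma Cmod_pow_taylor_le (r : R) (x y : C) (n : nat) :
  Cmod x <= r -> Cmod y <= r ->
  Cmod (x ^ S (S n) - y ^ S (S n) - INR (S (S n)) * y ^ S n * (x - y))
  <= INR (S (S n)) * INR (S n) * r ^ n * Cmod (x - y) ^ 2.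
Proof.
  intros Hx Hy.
  assert (Hr := Rle_trans _ _ _ (Cmod_ge_0 x) Hx).
  assert (Hd := Cmod_ge_0 (x - y)).
  induction n as [|n IH].
  - replace (x ^ 2 - y ^ 2 - INR 2 * y ^ 1 * (x - y))%C with ((x - y) ^ 2)%C.
    + rewrite Cmod_pow. simpl. nra.
    + simpl INR. rewrite RtoC_plus. simpl. ring.
  - replace (x ^ S (S (S n)) - y ^ S (S (S n))
               - INR (S (S (S n))) * y ^ S (S n) * (x - y))%C
      with (x * (x ^ S (S n) - y ^ S (S n) - INR (S (S n)) * y ^ S n * (x - y))
            + INR (S (S n)) * y ^ S n * (x - y) ^ 2)%C.
    + eapply Rle_trans; [apply Cmod_triangle|]. rewrite !Cmod_mult, !Cmod_pow.
      rewrite Cmod_R, Rabs_pos_eq by apply pos_INR.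
      eapply Rle_trans.
      * apply Rplus_le_compat.
        -- apply Rmult_le_compat; [apply Cmod_ge_0|apply Cmod_ge_0|exact Hx|exact IH].
        -- apply Rmult_le_compat_r; [apply pow_le, Hd|].
           apply Rmult_le_compat_l; [apply pos_INR|].
           apply pow_incr. split; [apply Cmod_ge_0|exact Hy].
      * rewrite (S_INR (S (S n))), (S_INR (S n)).
        assert (Hn := pos_INR (S n)).
        assert (Hp : 0 <= r ^ n * r * Cmod (x - y) ^ 2)
          by (apply Rmult_le_pos;
              [apply Rmult_le_pos; [apply pow_le|]; exact Hr|apply pow2_ge_0]).
        assert (Hnp := Rmult_le_pos _ _ Hn Hp).
        simpl (r ^ S n). lra.
    + rewrite (S_INR (S (S n))), RtoC_plus. simpl. ring.
Qed.

(** Termwise, [|x^n - y^n| <= n r^(n-1) |x - y|], and the factor [n] turns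
    [1/n!] into [1/(n-1)!]. *)
Lemma CPSeries_lipschitz (K r : R) (a : nat -> C) (x y : C) :
  exp_bounded K a -> Cmod x <= r -> Cmod y <= r ->
  Cmod (CPSeries a x - CPSeries a y) <= K * exp r * Cmod (x - y).
Proof.
  intros Ha Hx Hy.
  assert (H := is_series_C_minus _ _ _ _
                 (CPSeries_correct K a x Ha) (CPSeries_correct K a y Ha)).
  apply (fun h => proj1 (is_series_shift _ _) h) in H. cbv beta in H.
  replace (CPSeries a x - CPSeries a y - (a 0%nat * x ^ 0 - a 0%nat * y ^ 0))%C
    with (CPSeries a x - CPSeries a y)%C in H by (simpl; ring).
  apply (is_series_Cmod_le _
           (fun n => (K * Cmod (x - y)) * (r ^ n / INR (fact n)))
           _ ((K * Cmod (x - y)) * exp r)) in H.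
  - eapply Rle_trans; [exact H|]. right. ring.
  - intros n.
    replace (a (S n) * x ^ S n - a (S n) * y ^ S n)%C
      with (a (S n) * (x ^ S n - y ^ S n))%C by ring.
    rewrite Cmod_mult.
    eapply Rle_trans.
    + apply Rmult_le_compat; [apply Cmod_ge_0|apply Cmod_ge_0|apply Ha|].
      exact (Cmod_pow_sub_le r x y n Hx Hy).
    + right. rewrite fact_simpl, mult_INR. field.
      split; [apply INR_fact_neq_0|apply not_0_INR; lia].
  - apply is_series_exp_scal.
Qed.

(** As for the Lipschitz bound, with the second-order remainder of [x^n] and two
    factors taken from the factorial. *)
Lemma CPSeries_taylor (K r : R) (a : nat -> C) (x y : C) :
  exp_bounded K a -> Cmod x <= r -> Cmod y <= r ->
  Cmod (CPSeries a x - CPSeries a y - CPSeries (derive_coefs a) y * (x - y))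
  <= K * exp r * Cmod (x - y) ^ 2.
Proof.
  intros Ha Hx Hy.
  assert (H := is_series_C_minus _ _ _ _
                 (CPSeries_correct K a x Ha) (CPSeries_correct K a y Ha)).
  apply (fun h => proj1 (is_series_shift _ _) h) in H.
  assert (Hd := is_series_C_scal (x - y) _ _
                  (CPSeries_correct K _ y (exp_bounded_derive K a Ha))).
  assert (Hs := is_series_C_minus _ _ _ _ H Hd).
  apply (fun h => proj1 (is_series_shift _ _) h) in Hs. cbv beta in Hs.
  match type of Hs with is_series _ ?l =>
    replace l with (CPSeries a x - CPSeries a y
                    - CPSeries (derive_coefs a) y * (x - y))%C in Hs
  end.
  - apply (is_series_Cmod_le _
             (fun n => (K * Cmod (x - y) ^ 2) * (r ^ n / INR (fact n)))
             _ ((K * Cmod (x - y) ^ 2) * exp r)) in Hs.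
    + eapply Rle_trans; [exact Hs|]. right. ring.
    + intros n. unfold derive_coefs.
      replace (a (S (S n)) * x ^ S (S n) - a (S (S n)) * y ^ S (S n)
               - (x - y) * (INR (S (S n)) * a (S (S n)) * y ^ S n))%C
        with (a (S (S n)) *
              (x ^ S (S n) - y ^ S (S n) - INR (S (S n)) * y ^ S n * (x - y)))%C
        by ring.
      rewrite Cmod_mult.
      eapply Rle_trans.
      * apply Rmult_le_compat; [apply Cmod_ge_0|apply Cmod_ge_0|apply Ha|].
        exact (Cmod_pow_taylor_le r x y n Hx Hy).
      * right. rewrite !fact_simpl, !mult_INR. field.
        repeat split; first [apply INR_fact_neq_0|apply not_0_INR; lia].
    + apply is_series_exp_scal.
  - unfold derive_coefs. simpl. ring.
Qed.

Lemma CPSeries_differentiable (K : R) (a : nat -> C) (z : C) :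
  exp_bounded K a -> C_differentiable (CPSeries a) z.
Proof.
  intros Ha. apply C_differentiable_Cmod.
  exists (CPSeries (derive_coefs a) z). intros eps Heps.
  set (M := K * exp (Cmod z + 1)).
  assert (HM : 0 <= M).
  { apply Rmult_le_pos; [exact (exp_bounded_ge_0 K a Ha)|].
    apply Rlt_le, exp_pos. }
  exists (Rmin 1 (eps / (M + 1))). split.
  - apply Rmin_glb_lt; [lra|apply Rdiv_lt_0_compat; lra].
  - intros w Hw. apply Rmin_Rgt_l in Hw as [Hw1 Hw2].
    assert (Hwz : Cmod w <= Cmod z + 1).
    { replace w with (z + (w - z))%C by ring.
      eapply Rle_trans; [apply Cmod_triangle|lra]. }
    eapply Rle_trans; [apply (CPSeries_taylor K (Cmod z + 1)); [exact Ha|exact Hwz|lra]|].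
    fold M. simpl. rewrite Rmult_1_r, <- Rmult_assoc.
    apply Rmult_le_compat_r; [apply Cmod_ge_0|].
    apply Rle_trans with ((M + 1) * (eps / (M + 1))).
    + apply Rmult_le_compat; [exact HM|apply Cmod_ge_0|lra|lra].
    + right. field. lra.
Qed.

(** By the Taylor bound the deviation is governed by the derivative, which is
    Lipschitz and equal to 1 at 0. *)
Lemma CPSeries_near_id (K : R) (a : nat -> C) :
  exp_bounded K a -> a 1%nat = 1%C ->
  exists r, 0 < r /\ near_id (CPSeries a) r.
Proof.
  intros Ha Ha1.
  assert (HK := exp_bounded_ge_0 K a Ha). assert (He := exp_pos 1).
  set (M := K * exp 1).
  assert (HM : 0 <= M) by (apply Rmult_le_pos; lra).
  (* the two error terms below add up to at most 3 M r *)
  set (r := / (6 * M + 1)).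
  assert (Hr0 : 0 < r) by (apply Rinv_0_lt_compat; lra).
  assert (HrM : (6 * M + 1) * r = 1) by (unfold r; field; lra).
  assert (Hr1 : r <= 1) by nra.
  exists r. split; [exact Hr0|]. intros x y Hx Hy.
  assert (Hd := Cmod_ge_0 (x - y)).
  assert (Hxy : Cmod (x - y) <= 2 * r).
  { unfold Cminus. eapply Rle_trans; [apply Cmod_triangle|].
    rewrite Cmod_opp. lra. }
  assert (Ht := CPSeries_taylor K 1 a x y Ha ltac:(lra) ltac:(lra)).
  assert (Hl := CPSeries_lipschitz K 1 _ y 0 (exp_bounded_derive K a Ha)
                  ltac:(lra) ltac:(rewrite Cmod_0; lra)).
  rewrite CPSeries_0 in Hl. fold M in Ht, Hl.
  replace (derive_coefs a 0) with (RtoC 1) in Hl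
    by (unfold derive_coefs; rewrite Ha1; simpl; ring).
  replace (y - 0)%C with y in Hl by ring.
  replace (CPSeries a x - CPSeries a y - (x - y))%C
    with ((CPSeries a x - CPSeries a y - CPSeries (derive_coefs a) y * (x - y))
          + (CPSeries (derive_coefs a) y - 1) * (x - y))%C by ring.
  eapply Rle_trans; [apply Cmod_triangle|]. rewrite Cmod_mult.
  assert (H1 : M * Cmod (x - y) ^ 2 <= M * (2 * r) * Cmod (x - y)).
  { simpl. rewrite Rmult_1_r, <- Rmult_assoc.
    apply Rmult_le_compat_r; [exact Hd|]. apply Rmult_le_compat_l; assumption. }
  assert (H2 : Cmod (CPSeries (derive_coefs a) y - 1) * Cmod (x - y)
               <= M * r * Cmod (x - y)).
  { apply Rmult_le_compat_r; [exact Hd|].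
    eapply Rle_trans; [exact Hl|]. apply Rmult_le_compat_l; assumption. }
  assert (H3 : 3 * (M * r) <= / 2) by nra.
  assert (H4 : 3 * (M * r) * Cmod (x - y) <= / 2 * Cmod (x - y))
    by (apply Rmult_le_compat_r; assumption).
  lra.
Qed.

(** * Cauchy products of complex series *)

Lemma sum_n_convolution {K : Ring} (a b : nat -> K) (N : nat) :
  sum_n (fun n => sum_n (fun k => mult (a k) (b (n - k)%nat)) n) N
  = sum_n (fun k => mult (a k) (sum_n b (N - k))) N.
Proof.
  induction N as [|N IH].
  - now rewrite !sum_O.
  - rewrite sum_Sn, IH, (sum_Sn (fun k => mult (a k) (b _))).
    rewrite (sum_Sn (fun k => mult (a k) (sum_n b _))).
    rewrite plus_assoc, <- sum_n_plus, !Nat.sub_diag, sum_O.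
    f_equal. apply sum_n_ext_loc. intros k Hk.
    rewrite Nat.sub_succ_l, sum_Sn, mult_distr_l by lia. reflexivity.
Qed.

(** The product of two partial sums exceeds the partial sum of the Cauchy product
    by terms that only involve tails of [b].  Over a general ring, to be used
    both for the complex terms and for their moduli. *)
Lemma sum_n_product {K : Ring} (a b : nat -> K) (N : nat) :
  mult (sum_n a N) (sum_n b N)
  = plus (sum_n (fun n => sum_n (fun k => mult (a k) (b (n - k)%nat)) n) N)
      (sum_n (fun k => mult (a k) (minus (sum_n b N) (sum_n b (N - k)))) N).
Proof.
  rewrite sum_n_convolution, <- sum_n_plus, <- sum_n_mult_r.
  apply sum_n_ext. intros k.
  rewrite <- mult_distr_l. f_equal. unfold minus.
  rewrite (plus_comm (sum_n b N)), plus_assoc.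
  rewrite (plus_opp_r (G := Ring.AbelianGroup K)). symmetry. apply plus_zero_l.
Qed.

Lemma sum_n_Cmod_sub_le (b : nat -> C) (M N : nat) :
  (M <= N)%nat ->
  Cmod (sum_n b N - sum_n b M)
  <= sum_n (fun n => Cmod (b n)) N - sum_n (fun n => Cmod (b n)) M.
Proof.
  induction 1 as [|N HMN IH].
  - replace (sum_n b M - sum_n b M)%C with (RtoC 0) by ring. rewrite Cmod_0. lra.
  - rewrite !sum_Sn.
    change (Cmod (sum_n b N + b (S N) - sum_n b M)
            <= sum_n (fun n => Cmod (b n)) N + Cmod (b (S N))
               - sum_n (fun n => Cmod (b n)) M).
    replace (sum_n b N + b (S N) - sum_n b M)%C
      with ((sum_n b N - sum_n b M) + b (S N))%C by ring.
    eapply Rle_trans; [apply Cmod_triangle|]. lra.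
Qed.

Lemma sum_n_Cmod_le (a : nat -> C) (b : nat -> R) (N : nat) :
  (forall n, (n <= N)%nat -> Cmod (a n) <= b n) ->
  Cmod (sum_n a N) <= sum_n b N.
Proof.
  intros H. induction N as [|N IH].
  - rewrite !sum_O. apply H. lia.
  - rewrite !sum_Sn. eapply Rle_trans; [apply Cmod_triangle|].
    apply Rplus_le_compat; [apply IH; intros n Hn; apply H; lia|apply H; lia].
Qed.

Lemma sum_n_RtoC (a : nat -> R) (n : nat) :
  sum_n (fun k => RtoC (a k)) n = RtoC (sum_n a n).
Proof.
  induction n as [|n IH]; [now rewrite !sum_O|].
  rewrite !sum_Sn, IH. symmetry. apply (RtoC_plus (sum_n a n)).
Qed.

(** The discrepancy between product of partial sums and partial Cauchy sum is
    dominated by the same discrepancy for the moduli, which tends to 0 by the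
    theorem for real series. *)
Lemma is_series_C_mult (a b : nat -> C) (la lb : C) :
  is_series a la -> is_series b lb ->
  ex_series (fun n => Cmod (a n)) -> ex_series (fun n => Cmod (b n)) ->
  is_series (fun n => sum_n (fun k => a k * b (n - k)%nat)%C n) (la * lb)%C.
Proof.
  intros Ha Hb [ma Hma] [mb Hmb].
  assert (Habs : forall c : nat -> C, forall m, is_series (fun n => Cmod (c n)) m ->
                 ex_series (fun n => Rabs (Cmod (c n)))).
  { intros c m H. exists m. revert H. apply is_series_ext. intros n.
    symmetry. apply Rabs_pos_eq, Cmod_ge_0. }
  assert (Hm := is_series_mult _ _ _ _ Hma Hmb (Habs _ _ Hma) (Habs _ _ Hmb)).
  set (A := sum_n a). set (B := sum_n b).
  set (A' := sum_n (fun n => Cmod (a n))). set (B' := sum_n (fun n => Cmod (b n))).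
  set (P := sum_n (fun n => sum_n (fun k => a k * b (n - k)%nat)%C n)).
  set (P' := sum_n (fun n => sum_n (fun k => Cmod (a k) * Cmod (b (n - k)%nat)) n)).
  assert (HP' : is_lim_seq (fun n => A' n * B' n - P' n) 0).
  { replace 0 with (ma * mb - ma * mb) by ring.
    apply is_lim_seq_minus'.
    - apply is_lim_seq_mult'; assumption.
    - eapply is_lim_seq_ext; [|exact Hm].
      intros n. apply sum_n_ext. intros k. symmetry.
      apply (sum_n_Reals (fun k0 => Cmod (a k0) * Cmod (b (k - k0)%nat))). }
  apply is_series_Cmod in Ha. apply is_series_Cmod in Hb. apply is_series_Cmod.
  fold P A B in Ha, Hb |- *.
  (* the truncation error of the product is at most that of the moduli *)
  assert (HAB : forall n, Cmod (P n - A n * B n) <= A' n * B' n - P' n).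
  { intros n.
    assert (E := sum_n_product (K := C_Ring) a b n).
    change (A n * B n = P n + sum_n (fun k => a k * (B n - B (n - k)%nat)) n)%C in E.
    assert (E' := sum_n_product (K := R_Ring)
                    (fun n => Cmod (a n)) (fun n => Cmod (b n)) n).
    change (A' n * B' n
            = P' n + sum_n (fun k => Cmod (a k) * (B' n - B' (n - k)%nat)) n) in E'.
    rewrite E, E'.
    replace (P n - (P n + sum_n (fun k => a k * (B n - B (n - k)%nat)) n))%C
      with (- sum_n (fun k => a k * (B n - B (n - k)%nat)) n)%C by ring.
    rewrite Cmod_opp.
    rewrite Rplus_minus_l.
    apply sum_n_Cmod_le. intros k _. rewrite Cmod_mult.
    apply Rmult_le_compat_l; [apply Cmod_ge_0|].
    apply sum_n_Cmod_sub_le. lia. }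
  apply (is_lim_seq_le_le (fun _ => 0) _
           (fun n => (A' n * B' n - P' n)
                     + (Cmod (A n - la) * (Cmod (B n - lb) + Cmod lb)
                        + Cmod la * Cmod (B n - lb)))).
  - intros n. split; [apply Cmod_ge_0|].
    replace (P n - la * lb)%C
      with ((P n - A n * B n)
            + ((A n - la) * ((B n - lb) + lb) + la * (B n - lb)))%C by ring.
    eapply Rle_trans; [apply Cmod_triangle|].
    apply Rplus_le_compat; [apply HAB|].
    eapply Rle_trans; [apply Cmod_triangle|]. rewrite !Cmod_mult.
    apply Rplus_le_compat_r, Rmult_le_compat_l; [apply Cmod_ge_0|].
    apply Cmod_triangle.
  - apply is_lim_seq_const.
  - replace 0 with (0 + (0 * (0 + Cmod lb) + Cmod la * 0)) by ring.
    apply is_lim_seq_plus'; [exact HP'|].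
    apply is_lim_seq_plus'; apply is_lim_seq_mult';
      try assumption; try apply is_lim_seq_const.
    apply is_lim_seq_plus'; [assumption|apply is_lim_seq_const].
Qed.

(** * The solution of F(2 phi z) = F(z)^2 - 1 *)

Lemma phi_bounds : 8 / 5 < phi < 2.
Proof.
  unfold phi.
  assert (H1 : 11 / 5 < sqrt 5).
  { apply Rsqr_incrst_0; [|lra|apply sqrt_pos].
    rewrite Rsqr_sqrt by lra. unfold Rsqr. lra. }
  assert (H2 : sqrt 5 < 3).
  { apply Rsqr_incrst_0; [|apply sqrt_pos|lra].
    rewrite Rsqr_sqrt by lra. unfold Rsqr. lra. }
  lra.
Qed.

Lemma phi_sqr : phi * phi = 1 + phi.
Proof.
  unfold phi. assert (H := sqrt_sqrt 5 ltac:(lra)). nra.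
Qed.

(** Row [N] holds the right values in columns 0 to [N]; the table turns the
    course-of-values recursion into a structural one. *)
Fixpoint poincare_table (N : nat) : nat -> R :=
  match N with
  | O => fun _ => 1
  | S M => fun n =>
      if (n <=? M)%nat then poincare_table M n
      else sum_n (fun k => poincare_table M k * poincare_table M (M - k)%nat) M
           / ((2 * phi) ^ S (S M) - 2 * phi)
  end.

(** The coefficient of [z^(n+1)]. *)
Definition poincare_tail (n : nat) : R := poincare_table n n.

Lemma poincare_table_stable (N n : nat) :
  (n <= N)%nat -> poincare_table N n = poincare_tail n.
Proof.
  induction N as [|N IH]; intros Hn.
  - now replace n with 0%nat by lia.
  - destruct (Nat.eq_dec n (S N)) as [->|Hne]; [reflexivity|].
    simpl. destruct (Nat.leb_spec n N); [apply IH; lia|lia].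
Qed.

Lemma poincare_tail_S (n : nat) :
  poincare_tail (S n)
  = sum_n (fun k => poincare_tail k * poincare_tail (n - k)) n
    / ((2 * phi) ^ S (S n) - 2 * phi).
Proof.
  unfold poincare_tail at 1. cbn [poincare_table].
  rewrite (proj2 (Nat.leb_gt (S n) n)) by lia.
  unfold Rdiv. f_equal. apply sum_n_ext_loc. intros k Hk.
  rewrite !poincare_table_stable by lia. reflexivity.
Qed.

(** Since [2 phi > 2], the divisor outgrows the number [2^(n+2) - 2] that the
    binomial theorem produces in the numerator of the recursion. *)
Lemma poincare_divisor_ge (n : nat) :
  2 * (2 ^ S (S n) - 2) <= (2 * phi) ^ S (S n) - 2 * phi.
Proof.
  assert (Hb := phi_bounds). assert (Hs := phi_sqr).
  induction n as [|n IH].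
  - simpl. nra.
  - assert (Hp : 2 <= 2 ^ S (S n)).
    { replace 2 with (2 ^ 1) at 1 by ring. apply Rle_pow; [lra|lia]. }
    rewrite <- (tech_pow_Rmult 2 (S (S n))),
            <- (tech_pow_Rmult (2 * phi) (S (S n))).
    nra.
Qed.

Lemma poincare_divisor_pos (n : nat) : 0 < (2 * phi) ^ S (S n) - 2 * phi.
Proof.
  assert (H := poincare_divisor_ge n).
  assert (Hp : 4 <= 2 ^ S (S n)).
  { replace 4 with (2 ^ 2) by ring. apply Rle_pow; [lra|lia]. }
  lra.
Qed.

Lemma poincare_convolution (n : nat) :
  sum_n (fun k => poincare_tail k * poincare_tail (n - k)) n
  = poincare_tail (S n) * ((2 * phi) ^ S (S n) - 2 * phi).
Proof.
  rewrite poincare_tail_S. symmetry. unfold Rdiv.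
  rewrite Rmult_assoc, Rinv_l; [apply Rmult_1_r|].
  assert (H := poincare_divisor_pos n). lra.
Qed.

(** The binomial expansion of [(1 + 1)^(n+2)] without its two extreme terms. *)
Lemma sum_inv_fact (n : nat) :
  sum_n (fun k => / INR (fact (S k)) * / INR (fact (S (n - k)))) n
  = (2 ^ S (S n) - 2) / INR (fact (S (S n))) :> R.
Proof.
  assert (Hf : forall m, INR (fact m) <> 0) by apply INR_fact_neq_0.
  assert (H := binomial 1 1 (S (S n))).
  replace (1 + 1) with 2 in H by ring.
  rewrite tech5, decomp_sum in H by lia. simpl pred in H.
  rewrite sum_n_Reals.
  rewrite (sum_eq _ (fun k => Binomial.C (S (S n)) (S k) * 1 ^ S k * 1 ^ (S (S n) - S k)
                          * / INR (fact (S (S n))))).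
  - rewrite <- scal_sum.
    replace (Binomial.C (S (S n)) 0) with 1 in H.
    + replace (Binomial.C (S (S n)) (S (S n))) with 1 in H.
      * rewrite !pow1 in H. rewrite H. field. apply Hf.
      * unfold Binomial.C. rewrite Nat.sub_diag. simpl (fact 0). simpl (INR 1).
        field. apply Hf.
    + unfold Binomial.C. rewrite Nat.sub_0_r. simpl (fact 0). simpl (INR 1).
      field. apply Hf.
  - intros k Hk. rewrite !pow1. unfold Binomial.C.
    replace (S (S n) - S k)%nat with (S (n - k)) by lia.
    field. repeat split; apply Hf.
Qed.

(** With [b_k <= 2^-k / (k+1)!] for [k <= n], the convolution in the recursion is at
    most [2^-n (2^(n+2) - 2) / (n+2)!], and dividing by the divisor gains the
    missing factor 1/2. *)
Lemma poincare_tail_bounds (n : nat) :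
  0 <= poincare_tail n <= (/ 2) ^ n / INR (fact (S n)).
Proof.
  induction n as [n IH] using (well_founded_induction Nat.lt_wf_0).
  destruct n as [|n].
  - unfold poincare_tail. simpl. lra.
  - rewrite poincare_tail_S.
    set (D := (2 * phi) ^ S (S n) - 2 * phi).
    assert (HD : 2 * (2 ^ S (S n) - 2) <= D) by apply poincare_divisor_ge.
    assert (HD0 : 0 < D) by apply poincare_divisor_pos.
    assert (Hf : 0 < INR (fact (S (S n)))) by apply INR_fact_lt_0.
    assert (Hsum : 0 <= sum_n (fun k => poincare_tail k * poincare_tail (n - k)) n
                   <= (/ 2) ^ n * ((2 ^ S (S n) - 2) / INR (fact (S (S n))))).
    { rewrite <- sum_inv_fact, !sum_n_Reals, scal_sum. split.
      - rewrite <- (Rmult_0_l (INR (S n))), <- sum_cte.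
        apply sum_Rle. intros k Hk.
        apply Rmult_le_pos; apply IH; lia.
      - apply sum_Rle. intros k Hk.
        replace (/ INR (fact (S k)) * / INR (fact (S (n - k))) * (/ 2) ^ n)
          with (((/ 2) ^ k / INR (fact (S k)))
                * ((/ 2) ^ (n - k) / INR (fact (S (n - k))))).
        + apply Rmult_le_compat; apply IH; lia.
        + replace n with (k + (n - k))%nat at 4 by lia. rewrite pow_add.
          unfold Rdiv. ring. }
    destruct Hsum as [Hs1 Hs2]. split.
    + apply Rmult_le_pos; [exact Hs1|]. apply Rlt_le, Rinv_0_lt_compat, HD0.
    + apply Rmult_le_reg_r with D; [exact HD0|].
      unfold Rdiv at 1. rewrite Rmult_assoc, Rinv_l, Rmult_1_r by lra.
      eapply Rle_trans; [exact Hs2|].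
      apply Rle_trans with ((/ 2) ^ n * ((D / 2) / INR (fact (S (S n))))).
      * apply Rmult_le_compat_l; [apply pow_le; lra|].
        apply Rmult_le_compat_r; [apply Rlt_le, Rinv_0_lt_compat, Hf|lra].
      * right. rewrite <- (tech_pow_Rmult (/ 2) n). field. lra.
Qed.

Definition poincare_coef (n : nat) : C :=
  match n with O => phi | S m => poincare_tail m end.

Definition poincare (z : C) : C := CPSeries poincare_coef z.

Lemma poincare_coef_le (n : nat) :
  Cmod (poincare_coef n) <= 2 * ((/ 2) ^ n / INR (fact n)).
Proof.
  assert (Hb := phi_bounds).
  destruct n as [|n]; simpl poincare_coef; rewrite Cmod_R.
  - rewrite Rabs_pos_eq; simpl; lra.
  - destruct (poincare_tail_bounds n) as [H1 H2].
    rewrite Rabs_pos_eq by exact H1.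
    eapply Rle_trans; [exact H2|]. right.
    rewrite <- (tech_pow_Rmult (/ 2) n). field. apply INR_fact_neq_0.
Qed.

Lemma poincare_coef_bounded : exp_bounded 2 poincare_coef.
Proof.
  intros n. eapply Rle_trans; [apply poincare_coef_le|].
  assert (Hf := INR_fact_lt_0 n).
  assert (Hp : (/ 2) ^ n <= 1).
  { rewrite <- (pow1 n). apply pow_incr. lra. }
  apply Rmult_le_compat_l; [lra|]. unfold Rdiv.
  rewrite <- (Rmult_1_l (/ INR (fact n))) at 2.
  apply Rmult_le_compat_r; [apply Rlt_le, Rinv_0_lt_compat, Hf|exact Hp].
Qed.

Lemma poincare_0 : poincare 0 = phi.
Proof. apply CPSeries_0. Qed.

Lemma poincare_entire : entire poincare.
Proof.
  intros z. exact (CPSeries_differentiable 2 _ z poincare_coef_bounded).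
Qed.

(** The factor 1/2 in the exponent comes from the powers of 1/2 in the coefficient
    bound; it leaves room to absorb the constant 2 in the estimate of the
    order. *)
Lemma poincare_growth (z : C) : Cmod (poincare z) <= 2 * exp (Cmod z / 2).
Proof.
  apply (is_series_Cmod_le _ (fun n => 2 * ((Cmod z / 2) ^ n / INR (fact n)))
           _ _) with (2 := CPSeries_correct 2 _ z poincare_coef_bounded).
  - intros n. rewrite Cmod_mult, Cmod_pow.
    replace (2 * ((Cmod z / 2) ^ n / INR (fact n)))
      with (2 * ((/ 2) ^ n / INR (fact n)) * Cmod z ^ n).
    + apply Rmult_le_compat_r; [apply pow_le, Cmod_ge_0|apply poincare_coef_le].
    + unfold Rdiv. rewrite Rpow_mult_distr. ring.
  - apply is_series_exp_scal.
Qed.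

Lemma poincare_exponential_type : exponential_type poincare.
Proof.
  exists 2, (/ 2). split; [lra|]. split; [lra|]. intros z.
  replace (/ 2 * Cmod z) with (Cmod z / 2) by (unfold Rdiv; ring).
  apply poincare_growth.
Qed.

(** The exponent 1 itself is admissible: [2 exp (|z| / 2) <= exp |z|] as soon as
    [|z| >= 2]. *)
Lemma poincare_order : Rbar_le (order poincare) 1.
Proof.
  apply Glb_Rbar_correct. split; [lra|]. exists 2. split; [lra|].
  intros z Hz. rewrite Rpower_1 by lra.
  eapply Rle_trans; [apply poincare_growth|].
  replace (exp (Cmod z)) with (exp (Cmod z / 2) * exp (Cmod z / 2))
    by (rewrite <- exp_plus; f_equal; lra).
  apply Rmult_le_compat_r; [apply Rlt_le, exp_pos|].
  assert (H := exp_ineq1_le (Cmod z / 2)). lra.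
Qed.

Lemma poincare_tail_series (z : C) :
  is_series (fun n => poincare_tail n * z ^ S n)%C (poincare z - phi)%C.
Proof.
  assert (H := CPSeries_correct 2 _ z poincare_coef_bounded).
  apply (fun h => proj1 (is_series_shift _ _) h) in H. cbv beta in H.
  replace (poincare z - phi)%C
    with (CPSeries poincare_coef z - poincare_coef 0 * z ^ 0)%C; [exact H|].
  unfold poincare. simpl. ring.
Qed.

(** The recursion for the coefficients is this equation, read degree by degree. *)
Lemma poincare_functional (z : C) :
  poincare (2 * phi * z) = (poincare z * poincare z - 1)%C.
Proof.
  assert (HU := poincare_tail_series z).
  assert (Hq := poincare_tail_series (2 * phi * z)).
  assert (Hex : ex_series (fun n => Cmod (poincare_tail n * z ^ S n))).
  { apply (ex_series_incr_1 (fun n => Cmod (poincare_coef n * z ^ n))).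
    exact (ex_series_Cmod_exp_bounded 2 _ z poincare_coef_bounded). }
  assert (Hsq := is_series_C_mult _ _ _ _ HU HU Hex Hex).
  assert (Hd := is_series_C_minus _ _ _ _ Hq (is_series_C_scal (2 * phi) _ _ HU)).
  apply (fun h => proj1 (is_series_shift _ _) h) in Hd. cbv beta in Hd.
  (* with U = poincare - phi, the equation to prove is
     U(z)^2 = U(2 phi z) - 2 phi U(z); the term of degree 1 cancels on the right *)
  assert (E : ((poincare z - phi) * (poincare z - phi))%C
    = (poincare (2 * phi * z) - phi - 2 * phi * (poincare z - phi))%C).
  { apply (is_series_C_unique _ _ _ Hsq).
    match type of Hd with is_series _ ?l =>
      replace l with (poincare (2 * phi * z) - phi
                      - 2 * phi * (poincare z - phi))%C in Hd by (simpl; ring)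
    end.
    revert Hd. apply is_series_ext. intros n.
    rewrite (sum_n_ext_loc _
      (fun k => mult (RtoC (poincare_tail k * poincare_tail (n - k)))
                     (z ^ S (S n))%C)).
    - rewrite sum_n_mult_r, sum_n_RtoC, poincare_convolution.
      change (poincare_tail (S n) * (2 * phi * z) ^ S (S n)
              - 2 * phi * (poincare_tail (S n) * z ^ S (S n))
              = RtoC (poincare_tail (S n) * ((2 * phi) ^ S (S n) - 2 * phi))
                * z ^ S (S n))%C.
      rewrite Cpow_mult_l, RtoC_mult, RtoC_minus, RtoC_pow, RtoC_mult. ring.
    - intros k Hk.
      change ((poincare_tail k * z ^ S k)
                * (poincare_tail (n - k) * z ^ S (n - k))
              = RtoC (poincare_tail k * poincare_tail (n - k)) * z ^ S (S n))%C.
      replace (S (S n)) with (S k + S (n - k))%nat by lia.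
      rewrite Cpow_add_r, RtoC_mult. ring. }
  assert (Hs : (RtoC phi * phi = 1 + phi)%C).
  { rewrite <- RtoC_mult, phi_sqr, RtoC_plus. reflexivity. }
  replace (poincare (2 * phi * z))
    with ((poincare (2 * phi * z) - phi - 2 * phi * (poincare z - phi))
          + (2 * phi * poincare z + phi - 2 * (phi * phi)))%C by ring.
  rewrite <- E, Hs.
  replace ((poincare z - phi) * (poincare z - phi))%C
    with (poincare z * poincare z - 2 * phi * poincare z + phi * phi)%C by ring.
  rewrite Hs. ring.
Qed.

Lemma poincare_near_id : exists r, 0 < r /\ near_id poincare r.
Proof.
  apply (CPSeries_near_id 2); [exact poincare_coef_bounded|reflexivity].
Qed.

Lemma poincare_inverse :
  exists (r : R) (G : C -> C), 0 < r /\ G phi = 0%C /\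
    (forall z, Cmod z < r -> G (poincare z) = z) /\
    (forall w, Cmod (w - phi) < r ->
       poincare (G w) = w /\ C_differentiable G w).
Proof.
  destruct poincare_near_id as [r [Hr HF]].
  destruct (near_id_inverse poincare r Hr HF (fun z _ => poincare_entire z))
    as [G [HG1 HG2]].
  rewrite poincare_0 in HG2.
  exists (r / 2), G. split; [lra|]. split; [|split].
  - rewrite <- poincare_0. apply HG1. rewrite Cmod_0. exact Hr.
  - intros z Hz. apply HG1. lra.
  - intros w Hw. apply HG2. exact Hw.
Qed.

(** The derivative at 0 is 1, and the second-order error at [z / (2 phi)^n] is
    [O((2 phi)^(-2n))]. *)
Lemma poincare_linearization (z : C) :
  filterlim (fun n => RtoC (2 * phi) ^ n * (poincare (z / RtoC (2 * phi) ^ n) - phi))%C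
    eventually (locally z).
Proof.
  assert (Hb := phi_bounds).
  set (M := 2 * exp (Cmod z) * Cmod z ^ 2).
  assert (Hlim : is_lim_seq (fun n => M * (/ (2 * phi)) ^ n) 0).
  { replace 0 with (M * 0) by ring.
    apply is_lim_seq_mult'; [apply is_lim_seq_const|].
    apply is_lim_seq_geom.
    rewrite Rabs_pos_eq by (apply Rlt_le, Rinv_0_lt_compat; lra).
    rewrite <- Rinv_1. apply Rinv_lt_contravar; lra. }
  apply filterlim_Cmod. intros eps Heps.
  apply is_lim_seq_spec in Hlim.
  destruct (Hlim (mkposreal eps Heps)) as [N HN]. exists N. intros n Hn.
  specialize (HN n Hn). simpl in HN. rewrite Rminus_0_r in HN.
  eapply Rle_lt_trans; [|eapply Rle_lt_trans; [apply Rle_abs|exact HN]].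
  set (p := (2 * phi) ^ n).
  assert (Hp : 1 <= p) by (apply pow_R1_Rle; lra).
  rewrite <- RtoC_pow. fold p.
  assert (Hpc : RtoC p <> 0%C) by (intros E; apply RtoC_inj in E; lra).
  assert (Hz : Cmod (z / p) = Cmod z / p)
    by (rewrite Cmod_div, Cmod_R, Rabs_pos_eq by (exact Hpc || lra); reflexivity).
  assert (Hzp : Cmod (z / p) <= Cmod z).
  { rewrite Hz. apply Rmult_le_reg_r with p; [lra|].
    unfold Rdiv. rewrite Rmult_assoc, Rinv_l, Rmult_1_r by lra.
    rewrite <- (Rmult_1_r (Cmod z)) at 1.
    apply Rmult_le_compat_l; [apply Cmod_ge_0|exact Hp]. }
  assert (Ht := CPSeries_taylor 2 (Cmod z) poincare_coef (z / p) 0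
                  poincare_coef_bounded Hzp ltac:(rewrite Cmod_0; apply Cmod_ge_0)).
  rewrite !CPSeries_0 in Ht.
  change (derive_coefs poincare_coef 0) with (RtoC 1 * RtoC 1)%C in Ht.
  change (CPSeries poincare_coef (z / p)) with (poincare (z / p)) in Ht.
  change (poincare_coef 0) with (RtoC phi) in Ht.
  replace (z / p - 0)%C with (z / p)%C in Ht by ring.
  rewrite Hz in Ht.
  replace (p * (poincare (z / p) - phi) - z)%C
    with (p * (poincare (z / p) - phi - 1 * 1 * (z / p)))%C by (field; exact Hpc).
  rewrite Cmod_mult, Cmod_R, Rabs_pos_eq by lra.
  eapply Rle_trans; [apply Rmult_le_compat_l; [lra|exact Ht]|].
  right. rewrite pow_inv. fold p. unfold M. field. lra.
Qed.

(** * Nested square roots *)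

Lemma Csqrt_unique (a b : C) :
  0 < Re a -> 0 < Re b -> (a * a = b * b)%C -> a = b.
Proof.
  intros Ha Hb E.
  assert (Hne : (a + b)%C <> 0%C).
  { intros H. apply (f_equal Re) in H. simpl in H. unfold Re in *. lra. }
  assert (H : (a - b = 0)%C).
  { replace (a - b)%C with ((a * a - b * b) / (a + b))%C by (field; exact Hne).
    rewrite E. field. exact Hne. }
  replace a with (a - b + b)%C by ring. rewrite H. ring.
Qed.

Lemma Re_pos_near_phi (w : C) : Cmod (w - phi) < 1 -> 0 < Re w.
Proof.
  intros H. assert (Hb := phi_bounds).
  assert (H1 := re_le_Cmod (w - phi)).
  simpl in H1. unfold Rabs in H1. unfold Re. destruct Rcase_abs; lra.
Qed.

(** In the coordinate [z] given by [w = poincare z], any admissible branch of the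
    root is division by [2 phi]. *)
Lemma nested_sqrt_poincare (s : C -> C) :
  sqrt1_branch s ->
  locally (0 : C) (fun z => forall n,
    nested_sqrt s n (poincare z) = poincare (z / RtoC (2 * phi) ^ n)).
Proof.
  intros [Han [Hphi Hsq]]. assert (Hb := phi_bounds).
  assert (Hs := C_differentiable_continuous s phi (locally_singleton _ _ Han)
                  _ (locally_Cmod_ball _ 1 Rlt_0_1)).
  rewrite Hphi in Hs. cbv beta in Hs.
  destruct (proj1 (locally_Cmod _ _) (filter_and _ _ Hs Hsq)) as [d [Hd Hsd]].
  assert (Hc := C_differentiable_continuous poincare 0 (poincare_entire 0)
                  _ (locally_Cmod_ball _ (Rmin d 1) ltac:(apply Rmin_glb_lt; lra))).
  rewrite poincare_0 in Hc. cbv beta in Hc.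
  destruct (proj1 (locally_Cmod _ _) Hc) as [e [He Hpe]].
  assert (Hq : 1 <= 2 * phi) by lra.
  assert (Hqc : RtoC (2 * phi) <> 0%C) by (intros E; apply RtoC_inj in E; lra).
  assert (Hdiv : forall z, Cmod z < e -> Cmod (z / RtoC (2 * phi)) < e).
  { intros z Hz. rewrite Cmod_div, Cmod_R, Rabs_pos_eq by (exact Hqc || lra).
    assert (H := Cmod_ge_0 z). apply Rmult_lt_reg_r with (2 * phi); [lra|].
    unfold Rdiv. rewrite Rmult_assoc, Rinv_l by lra. nra. }
  (* both sides are square roots of 1 + poincare z in the right half-plane *)
  assert (Hstep : forall z, Cmod z < e ->
            s (poincare z) = poincare (z / RtoC (2 * phi))).
  { intros z Hz.
    assert (Hz1 := Hpe z ltac:(replace (z - 0)%C with z by ring; exact Hz)).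
    assert (Hz2 := Hpe (z / RtoC (2 * phi))%C
      ltac:(replace (z / RtoC (2 * phi) - 0)%C with (z / RtoC (2 * phi))%C by ring;
            exact (Hdiv z Hz))).
    apply Rmin_Rgt_l in Hz1 as [Hz1 _]. apply Rmin_Rgt_l in Hz2 as [_ Hz2].
    destruct (Hsd _ Hz1) as [Hs1 Hs2].
    apply Csqrt_unique; [exact (Re_pos_near_phi _ Hs1)|exact (Re_pos_near_phi _ Hz2)|].
    rewrite Hs2.
    replace (poincare z) with (poincare (2 * phi * (z / RtoC (2 * phi)))).
    - rewrite poincare_functional. ring.
    - f_equal. rewrite RtoC_mult in *. field.
      intros E. apply RtoC_inj in E. lra. }
  apply locally_Cmod. exists e. split; [exact He|]. intros z Hz.
  replace (z - 0)%C with z in Hz by ring.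
  assert (H : forall n, Cmod (z / RtoC (2 * phi) ^ n) < e /\
    nested_sqrt s n (poincare z) = poincare (z / RtoC (2 * phi) ^ n)).
  { induction n as [|n [IH1 IH2]].
    - simpl. replace (z / 1)%C with z by field. auto.
    - replace (z / RtoC (2 * phi) ^ S n)%C
        with (z / RtoC (2 * phi) ^ n / RtoC (2 * phi))%C
        by (simpl; field; split; [apply Cpow_nz|]; exact Hqc).
      split; [exact (Hdiv _ IH1)|].
      unfold nested_sqrt in *. simpl. rewrite IH2. exact (Hstep _ IH1). }
  intros n. apply H.
Qed.

(** The conjugate of division by [2 phi] is a branch of the root. *)
Lemma sqrt1_branch_exists : exists s : C -> C, sqrt1_branch s.
Proof.
  assert (Hb := phi_bounds).
  destruct poincare_inverse as (r & G & Hr & HG0 & _ & HG2).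
  assert (Hqc : (2 * phi)%C <> 0%C)
    by (rewrite <- RtoC_mult; intros E; apply RtoC_inj in E; lra).
  exists (fun w => poincare (/ (2 * phi) * G w)). split; [|split].
  - apply locally_Cmod. exists r. split; [exact Hr|]. intros w Hw.
    apply (C_differentiable_comp poincare (fun w => / (2 * phi) * G w)%C).
    + apply (C_differentiable_comp (fun w => / (2 * phi) * w)%C G).
      * apply HG2, Hw.
      * apply C_differentiable_scale.
    + apply poincare_entire.
  - rewrite HG0, Cmult_0_r. apply poincare_0.
  - apply locally_Cmod. exists r. split; [exact Hr|]. intros w Hw.
    assert (E := poincare_functional (/ (2 * phi) * G w)).
    replace (2 * phi * (/ (2 * phi) * G w))%C with (G w) in E
      by (field; intros E0; apply RtoC_inj in E0; lra).
    rewrite (proj1 (HG2 w Hw)) in E. rewrite E at 3. ring.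
Qed.

Theorem mainTheorem1 :
  (exists s : C -> C, sqrt1_branch s) /\
  forall s : C -> C, sqrt1_branch s ->
    (exists g : C -> C, is_nested_sqrt_limit s g) /\
    forall g : C -> C, is_nested_sqrt_limit s g ->
      analytic_at g phi /\
      (exists f : C -> C, is_local_inverse g f) /\
      forall f : C -> C, is_local_inverse g f ->
        exists F : C -> C,
          entire F /\
          locally (0 : C) (fun z => F z = f z) /\
          exponential_type F /\
          Rbar_le (order F) 1.
Proof.
  split; [exact sqrt1_branch_exists|]. intros s Hs.
  destruct poincare_inverse as (r & G & Hr & HG0 & HG1 & HG2).
  assert (Hball := locally_Cmod_ball phi r Hr).
  assert (HGcont := C_differentiable_continuous G phi
                      (proj2 (HG2 phi (locally_singleton _ _ Hball)))).
  rewrite HG0 in HGcont.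
  assert (HFcont := C_differentiable_continuous poincare 0 (poincare_entire 0)).
  rewrite poincare_0 in HFcont.
  (* on w = poincare (G w) the linearization limit is G w *)
  assert (HGlim : is_nested_sqrt_limit s G).
  { unfold is_nested_sqrt_limit.
    generalize (filter_and _ _ Hball (HGcont _ (nested_sqrt_poincare s Hs))).
    apply filter_imp. intros w [Hw Hn].
    apply (filterlim_ext (fun n => RtoC (2 * phi) ^ n
             * (poincare (G w / RtoC (2 * phi) ^ n) - phi))%C).
    - intros n. rewrite <- Hn, (proj1 (HG2 w Hw)). reflexivity.
    - apply poincare_linearization. }
  split; [exists G; exact HGlim|]. intros g Hg.
  unfold is_nested_sqrt_limit in HGlim, Hg.
  assert (HgG : locally (phi : C) (fun w => G w = g w)).
  { generalize (filter_and _ _ HGlim Hg). apply filter_imp. intros w [H1 H2].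
    exact (filterlim_locally_unique (V := C_NormedModule) _ _ _ H1 H2). }
  assert (HFg : locally (0 : C) (fun z => g (poincare z) = z)).
  { assert (H0 : locally (0 : C) (fun z => Cmod z < r)).
    { apply locally_Cmod. exists r. split; [exact Hr|]. intros z Hz.
      replace (z - 0)%C with z in Hz by ring. exact Hz. }
    generalize (filter_and _ _ H0 (HFcont _ HgG)). apply filter_imp.
    intros z [Hz E]. rewrite <- E. apply HG1, Hz. }
  split; [|split].
  - apply (analytic_at_ext_loc G); [exact HgG|].
    unfold analytic_at. revert Hball. apply filter_imp.
    intros w Hw. apply HG2, Hw.
  - exists poincare. split; [|split; [exact poincare_0|split; [exact HFg|]]].
    + exact (filter_forall _ poincare_entire).
    + generalize (filter_and _ _ Hball HgG). apply filter_imp.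
      intros w [Hw E]. rewrite <- E. apply HG2, Hw.
  - intros f (_ & _ & _ & Hf). exists poincare.
    split; [exact poincare_entire|]. split; [|split].
    + generalize (filter_and _ _ HFg (HFcont _ Hf)). apply filter_imp.
      intros z [E1 E2]. rewrite E1 in E2. symmetry. exact E2.
    + exact poincare_exponential_type.
    + exact poincare_order.
Qed.
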